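(* Let $f:[0,1]\to\mathbb{R}$ be a continuous function. Then for any integer $n>1$ we have $$\left| R_n(f;x)-f(x)\right| \le \omega\left(n^{-1/2}\right)\Big(1+x(1-x)\big(1-\min\{x,1-x\}\big)\Big),\qquad x\in[0,1],$$ where $\omega(\delta)=\omega^f(\delta)$ denotes the modulus of continuity of $f$. In particular, $$\left| R_n(f;x)-f(x)\right| \le \frac{31}{27}\,\omega\left(n^{-1/2}\right),\qquad x\in[0,1].$$
   Context: For $x,h\in\mathbb{R}$ and an integer $n\ge 0$, the generalized rising factorial with increment $h$ is $x^{(n,h)}=x(x+h)(x+2h)\cdots(x+(n-1)h)$, with the convention $x^{(0,h)}=1$. For an integer $n>1$, a function $f:[0,1]\to\mathbb{R}$ and $x\in[0,1]$, put $c=c(n,x)=-\frac{\min\{x,1-x\}}{n-1}$ and define $$R_n(f;x)=\sum_{k=0}^{n}\binom{n}{k}\frac{x^{(k,c)}\,(1-x)^{(n-k,c)}}{1^{(n,c)}}\,f\left(\frac{k}{n}\right).$$ The modulus of continuity of a continuous $f:[0,1]\to\mathbb{R}$ is $\omega^f(\delta)=\max\{|f(x)-f(y)| : x,y\in[0,1],\ |x-y|\le\delta\}$ for $\delta>0$. *)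

(* Defs.v *)
From HB Require Import structures.
From mathcomp Require Import all_boot all_order all_algebra.
From mathcomp Require Import all_classical all_reals all_analysis.

Set Implicit Arguments.
Unset Strict Implicit.
Unset Printing Implicit Defensive.

Import Order.TTheory GRing.Theory Num.Theory.
Import numFieldNormedType.Exports.

Local Open Scope classical_set_scope.
Local Open Scope ring_scope.

(* A function on [0, 1] is represented by a function on R of which only the
   restriction to [0, 1] matters. *)

Definition rising_fact (R : realType) (x : R) (n : nat) (h : R) : R :=
  \prod_(i < n) (x + i%:R * h).

Definition Rincr (R : realType) (n : nat) (x : R) : R :=
  - (Num.min x (1 - x) / (n%:R - 1)).

Definition Rop (R : realType) (n : nat) (f : R -> R) (x : R) : R :=
  let c := Rincr n x in
  \sum_(k < n.+1)
    'C(n, k)%:R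
    * (rising_fact x k c * rising_fact (1 - x) (n - k) c / rising_fact 1 n c)
    * f (k%:R / n%:R).

Definition increments (R : realType) (f : R -> R) (delta : R) : set R :=
  [set d | exists x y : R, [/\ x \in `[0, 1], y \in `[0, 1],
    `|x - y| <= delta & d = `|f x - f y|]].

(* This supremum is a maximum for continuous f: see modulus_max. *)
Definition modulus (R : realType) (f : R -> R) (delta : R) : R :=
  sup (increments f delta).

Lemma modulus_max (R : realType) (f : R -> R) (delta : R) :
  {within `[0, 1], continuous f} -> 0 < delta ->
  increments f delta (modulus f delta) /\
  ubound (increments f delta) (modulus f delta).
Proof.
move=> cf d0.
pose K : set (R * R) :=
  (`[0, 1]%classic `*` `[0, 1]%classic) `&` [set p | `|p.1 - p.2| <= delta].
have cK : compact K.
  apply: compact_closedI; first by apply: compact_setX; exact: segment_compact.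
  have -> : [set p : R * R | `|p.1 - p.2| <= delta] =
      (fun p : R * R => `|p.1 - p.2|) @^-1` [set z | z <= delta] by [].
  apply: preimage_closed; last exact: closed_le.
  move=> p _; apply: cvg_norm; apply: cvgB; [exact: cvg_fst|exact: cvg_snd].
have K0 : K !=set0.
  by exists (0, 0); do ?split; rewrite /= ?in_itv /= ?lexx ?ler01 ?subrr ?normr0 ?ltW.
have /subspace_continuousP cf' := cf.
have cg : {within K, continuous (fun p : R * R => `|f p.1 - f p.2|)}.
  apply/subspace_continuousP => -[a b] Kab; have [[/= a01 b01] _] := Kab.
  apply: cvg_norm; apply: cvgB => /=.
    apply: (cvg_comp _ _ _ (cf' a a01)) => A /=; rewrite !nbhs_simpl /within /=.
    move=> hA; have : \forall p \near (a, b), `[0, 1]%classic p.1 -> A p.1.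
      exact: (@cvg_fst _ _ (nbhs a) (nbhs b) _ _ hA).
    by apply: filterS => -[u v] /= h [[/= u01 _] _]; exact: h.
  apply: (cvg_comp _ _ _ (cf' b b01)) => A /=; rewrite !nbhs_simpl /within /=.
  move=> hA; have : \forall p \near (a, b), `[0, 1]%classic p.2 -> A p.2.
    exact: (@cvg_snd _ _ (nbhs a) (nbhs b) _ _ hA).
  by apply: filterS => -[u v] /= h [[/= _ v01] _]; exact: h.
have [[a b] /set_mem [[/= a01 b01] abd] m] := compact_EVT_max K0 cK cg.
have inc : increments f delta `|f a - f b| by exists a, b; split.
have ub : ubound (increments f delta) `|f a - f b|.
  move=> _ [x [y [x01 y01 xyd ->]]].
  by apply: (m (x, y)); apply/mem_set; do ?split.
have -> : modulus f delta = `|f a - f b|.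
  apply/eqP; rewrite eq_le; apply/andP; split.
    by apply: ge_sup => //; exists `|f a - f b|.
  by apply: ub_le_sup => //; exists `|f a - f b|.
by [].
Qed.

(* Main.v *)
Require Import Defs.
From mathcomp Require Import all_boot all_order all_algebra.
From mathcomp Require Import all_classical all_reals all_analysis.
From mathcomp Require Import ring lra.

Set Implicit Arguments.
Unset Strict Implicit.
Unset Printing Implicit Defensive.

Import Order.TTheory GRing.Theory Num.Theory.
Import numFieldNormedType.Exports.
Local Open Scope classical_set_scope.
Local Open Scope ring_scope.

(** For x in [0, 1], [R_n(.; x)] is the expectation of f(K/n), where K has a
    Polya urn distribution with the negative replacement c.  Vandermonde's
    identity for rising factorials gives its total mass and its factorial
    moments; K/n has mean x, and n times its variance is
    x(1-x)(1+nc)/(1+c) <= x(1-x)(1-min(x,1-x)).  The estimate then follows from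
    |f(y) - f(x)| <= omega(delta) (1 + |y-x|^2/delta^2) with delta = n^(-1/2). *)

(** * Rising factorials and the moments of the unnormalised weights *)

Section Rising.
Variable R : realType.
Implicit Types (x y h : R) (g : nat -> R).

Lemma rising_factSl x n h :
  rising_fact x n.+1 h = x * rising_fact (x + h) n h.
Proof.
rewrite /rising_fact big_ord_recl mul0r addr0; congr (_ * _).
by apply: eq_bigr => i _; rewrite lift0 -natr1; ring.
Qed.

(** Unnormalised expectation of [g] under the urn weights. The parameter [y] is kept free instead of
    being [1 - x], so that shifts of [x] or [y] by [h] stay inside the family. *)
Definition vsum n h x y g : R :=
  \sum_(k < n.+1) 'C(n, k)%:R * (rising_fact x k h * rising_fact y (n - k) h) * g k.

Lemma vsumD n h x y g1 g2 :
  vsum n h x y (fun k => g1 k + g2 k) = vsum n h x y g1 + vsum n h x y g2.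
Proof. by rewrite /vsum -big_split; apply: eq_bigr => i _; rewrite mulrDr. Qed.

Lemma vsumZ n h x y a g :
  vsum n h x y (fun k => a * g k) = a * vsum n h x y g.
Proof. by rewrite /vsum mulr_sumr; apply: eq_bigr => i _; rewrite mulrCA. Qed.

Lemma eq_vsum n h x y g1 g2 : g1 =1 g2 -> vsum n h x y g1 = vsum n h x y g2.
Proof. by move=> e; apply: eq_bigr => i _; rewrite e. Qed.

(** The term k = 0 vanishes, and k C(n+1, k) = (n+1) C(n, k-1) absorbs the factor k, while the first
    factor [x] of the rising factorial is released. Each use lowers the degree of a moment by
    one. *)
Lemma vsum_nat_mul n h x y g :
  vsum n.+1 h x y (fun k => k%:R * g k)
    = n.+1%:R * x * vsum n h (x + h) y (fun k => g k.+1).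
Proof.
rewrite /vsum big_ord_recl mul0r mulr0 add0r mulr_sumr.
apply: eq_bigr => i _; rewrite lift0 subSS rising_factSl.
have := congr1 (fun k : nat => k%:R : R) (mul_bin_diag n.+1 i).
rewrite /= !natrM => e.
transitivity ((i.+1%:R * 'C(n.+1, i.+1)%:R)
   * (x * rising_fact (x + h) i h * rising_fact y (n - i) h) * g i.+1); first by ring.
by rewrite -e; ring.
Qed.

Lemma vsum_rev n h x y g :
  vsum n h x y g = vsum n h y x (fun k => g (n - k)%N).
Proof.
rewrite /vsum (reindex_inj rev_ord_inj) /=; apply: eq_bigr => i _.
have li : (i <= n)%N by rewrite -ltnS.
by rewrite subSS bin_sub // subKn // [X in _ * X * _]mulrC.
Qed.

(* Splitting (n+1) g = k g + (n+1-k) g shifts either x or y by h. *)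
Lemma vandermonde_rising n h x y :
  vsum n h x y (fun=> 1) = rising_fact (x + y) n h.
Proof.
elim: n x y => [|n IH] x y.
  by rewrite /vsum big_ord1 /rising_fact !big_ord0 !mulr1.
have n0 : n.+1%:R != 0 :> R by rewrite pnatr_eq0.
apply: (mulfI n0); rewrite -vsumZ.
transitivity (vsum n.+1 h x y (fun k => k%:R * 1)
            + vsum n.+1 h x y (fun k => (n.+1 - k)%:R)).
  rewrite -vsumD; apply: eq_bigr => i _; congr (_ * _).
  by rewrite !mulr1 -natrD subnKC // -ltnS.
rewrite vsum_nat_mul IH [in X in _ + X]vsum_rev.
rewrite (_ : vsum _ _ y x _ = vsum n.+1 h y x (fun k => k%:R * 1)); last first.
  by apply: eq_bigr => i _; rewrite subKn ?mulr1 // -ltnS.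
rewrite vsum_nat_mul IH rising_factSl.
rewrite (_ : x + h + y = x + y + h); last by ring.
rewrite (_ : y + h + x = x + y + h); last by ring.
by ring.
Qed.

Lemma vsum_nat n h x y :
  vsum n.+1 h x y (fun k => k%:R) = n.+1%:R * x * rising_fact (x + y + h) n h.
Proof.
rewrite (@eq_vsum _ _ _ _ _ (fun k => k%:R * 1)); last by move=> k; rewrite mulr1.
by rewrite vsum_nat_mul vandermonde_rising addrAC.
Qed.

(** Absorbing one factor k turns the other into k + 1 after reindexing, which leaves a total mass
    and a mean at [x + h]. *)
Lemma vsum_sqr n h x y :
  vsum n.+2 h x y (fun k => k%:R ^+ 2)
    = n.+2%:R * x * (rising_fact (x + y + h) n.+1 h
        + n.+1%:R * (x + h) * rising_fact (x + y + h + h) n h).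
Proof.
rewrite vsum_nat_mul (@eq_vsum _ _ _ _ _ (fun k => 1 + k%:R)); last first.
  by move=> k; rewrite -natr1 addrC.
rewrite vsumD vandermonde_rising vsum_nat.
by rewrite [x + h + y]addrAC.
Qed.

End Rising.

(** * Growth of increments of f in terms of the modulus of continuity *)

Section Modulus.
Variables (R : realType) (f : R -> R).
Hypothesis cf : {within `[0, 1], continuous f}.
Implicit Types x y d : R.

Lemma le_modulus d x y : 0 < d -> x \in `[0, 1] -> y \in `[0, 1] ->
  `|x - y| <= d -> `|f x - f y| <= modulus f d.
Proof.
by move=> d0 x01 y01 xy; apply: (modulus_max cf d0).2; exists x, y.
Qed.

Lemma modulus_ge0 d : 0 < d -> 0 <= modulus f d.
Proof.
move=> d0; have i0 : (0 : R) \in `[0, 1] by rewrite in_itv /= lexx ler01.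
by apply: le_trans (le_modulus d0 i0 i0 _); rewrite ?subrr normr0 // ltW.
Qed.

(** Induction on [N]: the point [z], a fraction 1/(N+1) of the way from [x] to [y], splits off one
    step of length at most [d] and leaves a distance of at most N d. *)
Lemma le_modulus_nat N d x y : 0 < d -> x \in `[0, 1] -> y \in `[0, 1] ->
  `|x - y| <= N%:R * d -> `|f x - f y| <= N%:R * modulus f d.
Proof.
move=> d0; elim: N x y => [|N IH] x y x01 y01 xy.
  have : `|x - y| <= 0 by rewrite mul0r in xy.
  rewrite normr_le0 subr_eq0 => /eqP ->.
  by rewrite subrr normr0 mul0r.
pose t : R := N.+1%:R^-1; pose z := x + t * (y - x).
have N0 : 0 < N.+1%:R :> R by rewrite ltr0Sn.
have t0 : 0 <= t by rewrite invr_ge0 ltW.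
have t1 : t <= 1 by rewrite invf_le1 // ler1n.
have tN : t * N.+1%:R = 1 by rewrite mulVf // gt_eqF.
have z01 : z \in `[0, 1].
  move: x01 y01; rewrite !in_itv /= => /andP[x0 x1] /andP[y0 y1].
  by apply/andP; split; rewrite /z; nra.
have xz : `|x - z| <= d.
  have -> : x - z = t * (x - y) by rewrite /z; ring.
  rewrite normrM ger0_norm //.
  apply: le_trans (ler_wpM2l t0 xy) _; rewrite mulrA tN mul1r //.
have zy : `|z - y| <= N%:R * d.
  have tN' : 1 - t = t * N%:R by move: tN; rewrite -natr1 mulrDr mulr1; lra.
  have -> : z - y = (1 - t) * (x - y) by rewrite /z; ring.
  rewrite normrM ger0_norm ?subr_ge0 // tN'.
  apply: le_trans (ler_wpM2l _ xy) _; first exact: mulr_ge0.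
  have -> : t * N%:R * (N.+1%:R * d) = t * N.+1%:R * (N%:R * d) by ring.
  by rewrite tN mul1r.
rewrite -(subrKA (f z)) -natr1 mulrDl mul1r addrC.
apply: le_trans (ler_normD _ _) _; apply: lerD; first exact: IH.
exact: le_modulus.
Qed.

(** With [N] the integer part of [l], N + 1 steps of length [d] suffice. Since [N] is a natural
    number, N <= N^2 <= l^2; the inequality l <= l^2 itself fails for 0 < l < 1. *)
Lemma le_modulus_sqr d x y : 0 < d -> x \in `[0, 1] -> y \in `[0, 1] ->
  `|f x - f y| <= modulus f d * (1 + (x - y) ^+ 2 / d ^+ 2).
Proof.
move=> d0 x01 y01; pose l := `|x - y| / d.
have l0 : 0 <= l by rewrite divr_ge0 // ltW.
have [lN Nl] := andP (truncn_itv l0).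
set N := Num.truncn l in lN Nl.
apply: le_trans (@le_modulus_nat N.+1 d x y d0 x01 y01 _) _.
  by rewrite -ler_pdivrMr // ltW.
rewrite mulrC ler_wpM2l ?modulus_ge0 // -natr1 addrC lerD2l.
rewrite -[(x - y) ^+ 2]real_normK ?num_real // -expr_div_n -/l.
apply: (@le_trans _ _ (N%:R ^+ 2)); last by rewrite lerXn2r ?nnegrE.
by rewrite -natrX ler_nat; case: (N) => // k; rewrite leq_pmulr.
Qed.

End Modulus.

(** * Positivity, total mass and variance of the urn weights *)

Section Weights.
Variables (R : realType) (n : nat) (x : R).
Hypotheses (n_gt1 : (1 < n)%N) (x01 : x \in `[0, 1]).
Let m := Num.min x (1 - x).
Let c := Rincr n x.

Definition Rweight (k : nat) : R :=
  'C(n, k)%:R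
    * (rising_fact x k c * rising_fact (1 - x) (n - k) c / rising_fact 1 n c).

Lemma itv01P : 0 <= x <= 1. Proof. by move: x01; rewrite in_itv. Qed.

Lemma minx_bounds : [/\ 0 <= m, m <= x, m <= 1 - x & m <= 1 / 2].
Proof.
have /andP[x0 x1] := itv01P.
by rewrite /m /Num.min; case: ltP => h; split; lra.
Qed.

Lemma n1_gt0 : 0 < n%:R - 1 :> R.
Proof. by rewrite subr_gt0 ltr1n. Qed.

Lemma RincrM : (n%:R - 1) * c = - m.
Proof. by rewrite /c /Rincr mulrN mulrC divfK // gt_eqF // n1_gt0. Qed.

(** As c <= 0, the product is least at i = n - 1, where it equals -m. Hence no factor x + i c or 1 -
    x + i c in the weights is negative. *)
Lemma Rincr_ge (i : nat) : (i < n)%N -> - m <= i%:R * c.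
Proof.
move=> lin; have [m0 _ _ _] := minx_bounds; have n1 := n1_gt0.
have : i%:R <= n%:R - 1 :> R by rewrite lerBrDr natr1 ler_nat.
by have := RincrM; nra.
Qed.

Lemma rising_fact1_gt0 : 0 < rising_fact 1 n c.
Proof.
have [m0 mx my m2] := minx_bounds.
by apply: prodr_gt0 => i _; have := Rincr_ge (ltn_ord i); lra.
Qed.

Lemma Rweight_ge0 k : (k <= n)%N -> 0 <= Rweight k.
Proof.
move=> kn; have [m0 mx my m2] := minx_bounds.
rewrite /Rweight mulr_ge0 // mulr_ge0 //; last by rewrite invr_ge0 ltW ?rising_fact1_gt0.
rewrite mulr_ge0 //; apply: prodr_ge0 => i _.
  by have := Rincr_ge (leq_trans (ltn_ord i) kn); lra.
by have := Rincr_ge (leq_trans (ltn_ord i) (leq_subr _ _)); lra.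
Qed.

Lemma sum_Rweight_vsum g :
  \sum_(k < n.+1) Rweight k * g (k : nat)
    = vsum n c x (1 - x) g / rising_fact 1 n c.
Proof.
by rewrite /vsum mulr_suml; apply: eq_bigr => k _; rewrite /Rweight; ring.
Qed.

Lemma sum_Rweight : \sum_(k < n.+1) Rweight k = 1.
Proof.
transitivity (\sum_(k < n.+1) Rweight k * 1).
  by apply: eq_bigr => k _; rewrite mulr1.
rewrite (sum_Rweight_vsum (fun=> 1)) vandermonde_rising subrKC.
by rewrite divff // gt_eqF // rising_fact1_gt0.
Qed.

(** Here [N], [y], [h] stand for n, x, c, and [r] for the rising factorial of 1 + 2c with n - 2
    factors, common to all three moments and to the normalisation. *)
Lemma urn_variance_identity (N y h r : R) : N != 0 -> 1 + h != 0 -> r != 0 ->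
  N * ((N^-1 ^+ 2 * (N * y * ((1 + h) * r + (N - 1) * (y + h) * r))
        + - 2 * y / N * (N * y * ((1 + h) * r)) + y ^+ 2 * (1 * ((1 + h) * r)))
       / (1 * ((1 + h) * r)))
    = y * (1 - y) * ((1 + N * h) / (1 + h)).
Proof. by move=> N0 h0 r0; field; rewrite N0 h0 r0. Qed.

Lemma Rweight_variance :
  n%:R * (\sum_(k < n.+1) Rweight k * (k%:R / n%:R - x) ^+ 2)
    = x * (1 - x) * ((1 + n%:R * c) / (1 + c)).
Proof.
have n0 : n%:R != 0 :> R by rewrite pnatr_eq0 -lt0n ltnW.
rewrite (sum_Rweight_vsum (fun k => (k%:R / n%:R - x) ^+ 2)).
rewrite (@eq_vsum _ _ _ _ _ _ (fun k => (n%:R^-1 ^+ 2 * k%:R ^+ 2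
   + (- 2 * x / n%:R) * k%:R) + x ^+ 2 * 1)); last by move=> k; field.
rewrite 2!vsumD !vsumZ vandermonde_rising subrKC.
have := rising_fact1_gt0; move: n0 n_gt1.
(* From here [c] is any increment with a positive normalisation, whose factorisation makes both [r]
   and 1 + c nonzero; n = k + 2 is the form that the second moment requires. *)
move: c; clear; case: n => [//|[//|k]] c n0 _.
rewrite vsum_sqr vsum_nat subrKC !rising_factSl.
set r := rising_fact _ k _ => r0.
have r0' : r != 0 by apply: contraTneq r0 => ->; rewrite !mulr0 ltxx.
have c0 : 1 + c != 0 by apply: contraTneq r0 => ->; rewrite mul0r mulr0 ltxx.
rewrite (_ : k.+1%:R = k.+2%:R - 1); last by rewrite -[k.+2%:R]natr1 addrK.
exact: urn_variance_identity.
Qed.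

(** Since n c = c - m, the ratio (1 + n c)/(1 + c) is 1 - m/(1 + c), and 0 < 1 + c <= 1. *)
Lemma Rweight_variance_le :
  n%:R * (\sum_(k < n.+1) Rweight k * (k%:R / n%:R - x) ^+ 2)
    <= x * (1 - x) * (1 - m).
Proof.
have [m0 mx my m2] := minx_bounds; have n1 := n1_gt0; have e := RincrM.
have /andP[x0 x1] := itv01P.
have c1 : 0 < 1 + c.
  by have := Rincr_ge n_gt1; rewrite mul1r; lra.
rewrite Rweight_variance ler_wpM2l ?mulr_ge0 ?subr_ge0 // ler_pdivrMr //.
have -> : n%:R * c = c - m by rewrite -e; ring.
have : c <= 0 by nra.
nra.
Qed.

End Weights.

(** * The pointwise estimate and the uniform constant 31/27 *)

Theorem theorem5p2 (R : realType) (f : R -> R)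
    (cf : {within `[0, 1], continuous f}) (n : nat) (n_gt1 : (1 < n)%N) :
  (forall x : R, x \in `[0, 1] ->
     `|Rop n f x - f x| <=
       modulus f (n%:R `^ (- (1 / 2)))
       * (1 + x * (1 - x) * (1 - Num.min x (1 - x)))) /\
  (forall x : R, x \in `[0, 1] ->
     `|Rop n f x - f x| <= 31 / 27 * modulus f (n%:R `^ (- (1 / 2)))).
Proof.
have n0 : 0 < n%:R :> R by rewrite ltr0n ltnW.
set d : R := _ `^ _.
have d0 : 0 < d by rewrite powR_gt0.
have d2 : d ^+ 2 = n%:R^-1.
  by rewrite -powR_mulrn ?powR_ge0 // -powRrM mulNr mul1r mulVf // powR_inv1 // ltW.
have main (x : R) : x \in `[0, 1] -> `|Rop n f x - f x| <=
    modulus f d * (1 + x * (1 - x) * (1 - Num.min x (1 - x))).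
  move=> x01.
  (* The weights sum to 1, so f(x) can be moved inside the sum. *)
  have -> : Rop n f x - f x
      = \sum_(k < n.+1) Rweight n x k * (f (k%:R / n%:R) - f x).
    under [RHS]eq_bigr => k _ do rewrite mulrBr.
    by rewrite sumrB -mulr_suml sum_Rweight // mul1r.
  apply: le_trans (ler_norm_sum _ _ _) _.
  (* The factor n is 1/d^2; the sum of these bounds is the modulus times one plus n times the
     variance. *)
  apply: (@le_trans _ _ (\sum_(k < n.+1) (modulus f d * (Rweight n x k
      + n%:R * (Rweight n x k * (k%:R / n%:R - x) ^+ 2))))).
    apply: ler_sum => k _; have kn : (k <= n)%N by rewrite -ltnS.
    have w0 := Rweight_ge0 n_gt1 x01 kn.
    have k01 : (k%:R / n%:R : R) \in `[0, 1].
      by rewrite in_itv /= divr_ge0 // ler_pdivrMr // mul1r ler_nat.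
    rewrite normrM ger0_norm //.
    apply: le_trans (ler_wpM2l w0 (le_modulus_sqr cf d0 k01 x01)) _.
    by rewrite d2 invrK le_eqVlt; apply/orP; left; apply/eqP; ring.
  rewrite -mulr_sumr ler_wpM2l ?modulus_ge0 // big_split /= sum_Rweight //.
  by rewrite lerD2l -mulr_sumr Rweight_variance_le.
split=> // x x01; apply: le_trans (main x x01) _.
rewrite mulrC ler_wpM2r ?modulus_ge0 //.
have [m0 mx my m2] := minx_bounds x01.
(* By the symmetry of x(1-x), the bound depends on m alone: 1 + m(1-m)^2, which on [0, 1/2] is
   largest at m = 1/3, with value 31/27. *)
have -> : x * (1 - x) = Num.min x (1 - x) * (1 - Num.min x (1 - x)).
  by rewrite /Num.min; case: ifP => _; ring.
set m := Num.min _ _ in m0 m2 *.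
(* 4 - 27 m (1 - m)^2 = (1 - 3 m)^2 (4 - 3 m) *)
have : 0 <= (1 - 3 * m) ^+ 2 * (4 - 3 * m) by rewrite mulr_ge0 ?sqr_ge0 //; lra.
lra.
Qed.
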